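(* The rule $=_2$ is admissible in $cf.EQ_1$, and the rule $=_1$ is admissible in $cf.EQ_2$. That is, for every formula $F$, terms $r,s$ and free variable $v$ occurring neither in $r$ nor in $s$: if $\Gamma\Rightarrow F\{v/r\}$ is derivable in $cf.EQ_1$ then $\Gamma,s=r\Rightarrow F\{v/s\}$ is derivable in $cf.EQ_1$; and if $\Gamma\Rightarrow F\{v/r\}$ is derivable in $cf.EQ_2$ then $\Gamma,r=s\Rightarrow F\{v/s\}$ is derivable in $cf.EQ_2$.
   Context: The language is first-order with equality and function symbols; terms contain only free object variables. $F\{v/t\}$ is the result of simultaneously replacing all occurrences of the free object variable $v$ in $F$ by the term $t$. Sequents $\Gamma\Rightarrow H$ have a finite sequence $\Gamma$ of formulae as antecedent and exactly one formula $H$ as succedent. Equality rules ($v$ occurs neither in $r$ nor in $s$): $(=_1)$: from $\Gamma\Rightarrow F\{v/r\}$ infer $\Gamma,r=s\Rightarrow F\{v/s\}$; $(=_2)$: from $\Gamma\Rightarrow F\{v/r\}$ infer $\Gamma,s=r\Rightarrow F\{v/s\}$; $(=_1^l)$: from $\Gamma,F\{v/r\}\Rightarrow H$ infer $\Gamma,F\{v/s\},r=s\Rightarrow H$; $(=_2^l)$: from $\Gamma,F\{v/r\}\Rightarrow H$ infer $\Gamma,F\{v/s\},s=r\Rightarrow H$. For $i=1,2$, $cf.EQ_i$ is the calculus with logical axioms $F\Rightarrow F$ (every formula $F$), reflexivity axioms $\Rightarrow t=t$ (every term $t$), the left structural rules of weakening, exchange and contraction, and the equality rules $=_i$ and $=_i^l$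 (no cut rule). *)

(* Defs.v *)
From mathcomp Require Import all_boot.

Set Implicit Arguments.
Unset Strict Implicit.
Unset Printing Implicit Defensive.

Record signature := Signature {
  funsym : Type;
  funar : funsym -> nat;
  relsym : Type;
  relar : relsym -> nat
}.

(* Free and bound object variables form two disjoint countably infinite
   families, [fvar] and [bvar]. *)
Definition fvar := nat.
Definition bvar := nat.

Section Language.

Variable L : signature.

Inductive term : Type :=
| Var of fvar
| Fun (f : funsym L) of {ffun 'I_(funar f) -> term}.

Fixpoint occurs (v : fvar) (t : term) : bool :=
  match t with
  | Var w => w == v
  | Fun f a => [exists i, occurs v (a i)]
  end.

(* [sterm X] and [sformula X] are the expressions in which every bound variable
   that is not in the scope of a quantifier for it belongs to [X].  Bound variables are
   named, so alpha-variants are distinct. *)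
Inductive sterm (X : seq bvar) : Type :=
| SFree of fvar
| SBound x of x \in X
| SFun (f : funsym L) of {ffun 'I_(funar f) -> sterm X}.

Fixpoint sterm_of X (t : term) : sterm X :=
  match t with
  | Var w => SFree X w
  | Fun f a => SFun [ffun i => sterm_of X (a i)]
  end.

Inductive sformula (X : seq bvar) : Type :=
| Eq of sterm X & sterm X
| Rel (R : relsym L) of {ffun 'I_(relar R) -> sterm X}
| Bot
| Neg of sformula X
| And of sformula X & sformula X
| Or of sformula X & sformula X
| Imp of sformula X & sformula X
| All (x : bvar) of sformula (x :: X)
| Ex (x : bvar) of sformula (x :: X).

Definition formula := sformula [::].

Definition eqf (r s : term) : formula := Eq (sterm_of [::] r) (sterm_of [::] s).

Fixpoint ssubst X (v : fvar) (t : term) (u : sterm X) : sterm X :=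
  match u with
  | SFree w => if w == v then sterm_of X t else SFree X w
  | SBound x xX => SBound xX
  | SFun f a => SFun [ffun i => ssubst v t (a i)]
  end.

(* The substituted term has no bound variables, so capture cannot occur. *)
Fixpoint fsubst X (v : fvar) (t : term) (F : sformula X) : sformula X :=
  match F with
  | Eq a b => Eq (ssubst v t a) (ssubst v t b)
  | Rel R a => Rel [ffun i => ssubst v t (a i)]
  | Bot => Bot X
  | Neg A => Neg (fsubst v t A)
  | And A B => And (fsubst v t A) (fsubst v t B)
  | Or A B => Or (fsubst v t A) (fsubst v t B)
  | Imp A B => Imp (fsubst v t A) (fsubst v t B)
  | All x A => All (fsubst v t A)
  | Ex x A => Ex (fsubst v t A)
  end.

Definition subst (F : formula) (v : fvar) (t : term) : formula := fsubst v t F.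

End Language.

Notation "r ≐ s" := (eqf r s) (at level 70, no associativity).
Notation "F {[ v / t ]}" := (subst F v t)
  (at level 2, v at level 39, t at level 39, left associativity,
   format "F {[ v / t ]}").

Variant index := I1 | I2.

(* The equation introduced by the rules (=_i) and (=_i^l) when they replace
   [r] by [s]. *)
Definition eq_intro (L : signature) (i : index) (r s : term L) : formula L :=
  match i with
  | I1 => r ≐ s
  | I2 => s ≐ r
  end.

(* [cfEQ i G H]: the sequent G => H is derivable in cf.EQ_i.  Antecedents are
   written left to right, so "G, F" is [G ++ [:: F]]. *)
Inductive cfEQ (L : signature) (i : index) : seq (formula L) -> formula L -> Prop :=
| cf_ax (F : formula L) :
    cfEQ i [:: F] F
| cf_refl (t : term L) :
    cfEQ i [::] (t ≐ t)
| cf_weak (G : seq (formula L)) (F H : formula L) :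
    cfEQ i G H -> cfEQ i (G ++ [:: F]) H
| cf_exch (G D : seq (formula L)) (A B H : formula L) :
    cfEQ i (G ++ [:: A; B] ++ D) H -> cfEQ i (G ++ [:: B; A] ++ D) H
| cf_contr (G : seq (formula L)) (F H : formula L) :
    cfEQ i (G ++ [:: F; F]) H -> cfEQ i (G ++ [:: F]) H
| cf_eqr (G : seq (formula L)) (F : formula L) (v : fvar) (r s : term L) :
    ~~ occurs v r -> ~~ occurs v s ->
    cfEQ i G F{[v / r]} ->
    cfEQ i (G ++ [:: eq_intro i r s]) F{[v / s]}
| cf_eql (G : seq (formula L)) (F H : formula L) (v : fvar) (r s : term L) :
    ~~ occurs v r -> ~~ occurs v s ->
    cfEQ i (G ++ [:: F{[v / r]}]) H ->
    cfEQ i (G ++ [:: F{[v / s]}; eq_intro i r s]) H.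

(* Main.v *)
Require Import Defs.
From mathcomp Require Import all_boot.
From Stdlib Require List.

(** Read bottom-up, the equality rules of either calculus turn an equation in
    the antecedent into a one-way rewrite rule: in the presence of
    [eq_intro i r s], the term [s] may be replaced by [r], in the succedent
    ([cf_eqr]) and in the antecedent ([cf_eql]), equations included.  Call the
    set of all formulae obtained from [G] by such replacements its saturation;
    contraction and [cf_eql] make its members available at no cost
    ([cfEQ_cut_saturation]).  It follows that [G => H] is derivable exactly when
    [H] reduces, by the rules in the saturation of [G], either to a member of
    the saturation or to some [t ≐ t] ([cfEQ_rderivable], [rderivable_cfEQ]).

    The rule with the equation reversed asks for the opposite: from the fact
    that [F{[v / r]}] reduces to such a formula, where now [r] may be rewritten
    to [s], to conclude that [F{[v / s]}] does too.  As [F{[v / r]}] reduces to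
    [F{[v / s]}], confluence suffices.  It comes without any termination
    argument, because a saturation contains its critical pairs: if a redex
    [s'], given by [eq_intro i r' s'], has a proper part that is rewritten,
    yielding [s''], then that rewriting applies inside the equation as well, so
    [eq_intro i r' s''] is in the saturation and [s''] reduces to [r'].
    Parallel reduction, which contracts any set of disjoint redexes at once,
    therefore has the diamond property ([spar_diamond], [fpar_diamond]).  It
    is related to the calculi, whose rules replace one term at a time, by
    [step_closed_fpar]. *)

Set Implicit Arguments.
Unset Strict Implicit.
Unset Printing Implicit Defensive.

(** * Fresh variables *)

(** Fresh variables are chosen large; this form makes freshness conditions
    closed under finite conjunctions. *)
Definition eventually (Q : nat -> Prop) : Prop :=
  exists n, forall v, n <= v -> Q v.

Lemma eventually_and (Q1 Q2 : nat -> Prop) :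
  eventually Q1 -> eventually Q2 -> eventually (fun v => Q1 v /\ Q2 v).
Proof.
move=> [m Q1m] [n Q2n]; exists (maxn m n) => v.
by rewrite geq_max => /andP[/Q1m Q1v /Q2n].
Qed.

Lemma eventually_all (I : finType) (Q : I -> nat -> Prop) :
  (forall i, eventually (Q i)) -> eventually (fun v => forall i, Q i v).
Proof.
move=> /fin_all_exists[b Qb]; exists (\max_i b i) => v le_v i.
by apply: Qb; apply: leq_trans le_v; apply: leq_bigmax.
Qed.

Lemma eventually_imp (Q1 Q2 : nat -> Prop) :
  (forall v, Q1 v -> Q2 v) -> eventually Q1 -> eventually Q2.
Proof. by move=> sub [n Q1n]; exists n => v /Q1n/sub. Qed.

Section Language.

Variable L : signature.

(** The generated principles give no induction hypothesis for the arguments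
    of a function symbol, which sit inside a finite function. *)
Lemma term_nested_ind (Q : term L -> Prop) :
  (forall w, Q (Var L w)) ->
  (forall f (a : {ffun 'I_(funar f) -> term L}),
      (forall i, Q (a i)) -> Q (Fun a)) ->
  forall t, Q t.
Proof.
move=> QV QF; fix IH 1 => -[w|f a]; first exact: QV.
by apply: QF => i; apply: IH.
Qed.

Lemma sterm_nested_ind X (Q : sterm L X -> Prop) :
  (forall w, Q (SFree L X w)) ->
  (forall x (xX : x \in X), Q (SBound L xX)) ->
  (forall f (a : {ffun 'I_(funar f) -> sterm L X}),
      (forall i, Q (a i)) -> Q (SFun a)) ->
  forall u, Q u.
Proof.
move=> QV QB QF; fix IH 1 => -[w|x xX|f a]; [exact: QV|exact: QB|].
by apply: QF => i; apply: IH.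
Qed.

Lemma occurs_fresh (t : term L) : eventually (fun v => ~~ occurs v t).
Proof.
elim/term_nested_ind: t => [w|f a /eventually_all].
  by exists w.+1 => v; rewrite /=; case: eqP => // ->; rewrite ltnn.
by apply: eventually_imp => v fresh_v /=; apply/existsPn.
Qed.

Lemma ssubst_fresh X (u : sterm L X) :
  eventually (fun v => forall t, ssubst v t u = u).
Proof.
elim/sterm_nested_ind: u => [w|x xX|f a /eventually_all].
- by exists w.+1 => v; rewrite /=; case: eqP => // ->; rewrite ltnn.
- by exists 0.
apply: eventually_imp => v fresh_v t /=; congr SFun.
by apply/ffunP => i; rewrite ffunE.
Qed.

Lemma fsubst_fresh X (F : sformula L X) :
  eventually (fun v => forall t, fsubst v t F = F).
Proof.
elim: F => {X} [X a b|X R a|X|X A IH|X A IHA B IHB|X A IHA B IHB|X A IHA B IHB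
               |X x A IH|X x A IH] /=.
- apply: eventually_imp (eventually_and (ssubst_fresh a) (ssubst_fresh b)).
  by move=> v [Ea Eb] t; rewrite Ea Eb.
- have /eventually_all := fun i => ssubst_fresh (a i).
  apply: eventually_imp => v fresh_v t; congr Rel.
  by apply/ffunP => i; rewrite ffunE.
- by exists 0.
- by apply: eventually_imp IH => v E t; rewrite E.
- by apply: eventually_imp (eventually_and IHA IHB) => v [EA EB] t;
    rewrite EA EB.
- by apply: eventually_imp (eventually_and IHA IHB) => v [EA EB] t;
    rewrite EA EB.
- by apply: eventually_imp (eventually_and IHA IHB) => v [EA EB] t;
    rewrite EA EB.
- by apply: eventually_imp IH => v E t; rewrite E.
- by apply: eventually_imp IH => v E t; rewrite E.
Qed.

(** Serves as a left inverse of [sterm_of].  Its existence yields injectivity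
    of [sterm_of], which inversion of constructors would only give up to a
    transport along an equality of function symbols.  The value at a bound
    variable is arbitrary. *)
Fixpoint term_of X (u : sterm L X) : term L :=
  match u with
  | SFree w => Var L w
  | SBound _ _ => Var L 0
  | SFun f a => Fun [ffun i => term_of (a i)]
  end.

Lemma sterm_ofK X : cancel (@sterm_of L X) (@term_of X).
Proof.
elim/term_nested_ind => //= f a IH; congr Fun.
by apply/ffunP => i; rewrite !ffunE IH.
Qed.

(** * Parallel reduction *)

Section Parallel.

(** [R s r] is the rewrite rule replacing [s] by [r]. *)
Variable R : term L -> term L -> Prop.

(** The reduct is described by an equation instead of an index of an inductive
    family: then two reducts of [SFun a] are visibly headed by the same
    function symbol, and comparing them needs no uniqueness of identity
    proofs. *)
Fixpoint spar X (u u' : sterm L X) : Prop :=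
  (exists s r, [/\ R s r, u = sterm_of X s & u' = sterm_of X r]) \/
  match u with
  | SFree w => u' = SFree L X w
  | SBound x xX => u' = SBound L xX
  | SFun f a => exists2 a' : {ffun _ -> _},
                  u' = SFun (f := f) a' & forall i, spar (a i) (a' i)
  end.

Fixpoint fpar X (F : sformula L X) : sformula L X -> Prop :=
  match F with
  | Eq a b => fun G => exists a' b', [/\ G = Eq a' b', spar a a' & spar b b']
  | Rel T a => fun G => exists2 a' : {ffun _ -> _},
                 G = Rel (R := T) a' & forall i, spar (a i) (a' i)
  | Bot => fun G => G = Bot L _
  | Neg A => fun G => exists2 A', G = Neg A' & fpar A A'
  | And A B => fun G => exists A' B', [/\ G = And A' B', fpar A A' & fpar B B']
  | Or A B => fun G => exists A' B', [/\ G = Or A' B', fpar A A' & fpar B B']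
  | Imp A B => fun G => exists A' B', [/\ G = Imp A' B', fpar A A' & fpar B B']
  | All x A => fun G => exists2 A', G = All A' & fpar A A'
  | Ex x A => fun G => exists2 A', G = Ex A' & fpar A A'
  end.

Lemma spar_rule X s r : R s r -> spar (sterm_of X s) (sterm_of X r).
Proof. by move=> Rsr; case: s Rsr => *; left; do 2!eexists; split; eauto. Qed.

Lemma spar_fun X f (a a' : {ffun 'I_(funar f) -> sterm L X}) :
  (forall i, spar (a i) (a' i)) -> spar (SFun a) (SFun a').
Proof. by move=> aa'; right; exists a'. Qed.

Lemma spar_refl X (u : sterm L X) : spar u u.
Proof.
by elim/sterm_nested_ind: u => [w|x xX|f a IH]; [right|right|apply: spar_fun].
Qed.

Lemma spar_subst X v s r (u : sterm L X) :
  R s r -> spar (ssubst v s u) (ssubst v r u).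
Proof.
move=> Rsr; elim/sterm_nested_ind: u => [w|x xX|f a IH] /=; last first.
- by apply: spar_fun => i; rewrite !ffunE.
- by right.
by case: eqP => _; [apply: spar_rule|right].
Qed.

Lemma fpar_subst X v s r (F : sformula L X) :
  R s r -> fpar (fsubst v s F) (fsubst v r F).
Proof.
move=> Rsr; elim: F => {X} /=.
- by move=> X a b; do 2!eexists; split=> //; apply: spar_subst.
- move=> X T a; eexists; first by [].
  by move=> i; rewrite !ffunE; apply: spar_subst.
- by [].
- by move=> X A IH; eexists.
- by move=> X A IHA B IHB; do 2!eexists; split.
- by move=> X A IHA B IHB; do 2!eexists; split.
- by move=> X A IHA B IHB; do 2!eexists; split.
- by move=> X x A IH; eexists.
- by move=> X x A IH; eexists.
Qed.

(** Reduction never introduces bound variables, and it does not depend on which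
    bound variables are in scope.  The second fact lets a reduction found under
    quantifiers be performed inside an equation of the antecedent. *)
Lemma spar_sterm_of X s (u' : sterm L X) : spar (sterm_of X s) u' ->
  exists2 s', u' = sterm_of X s' &
    forall Y, spar (sterm_of Y s) (sterm_of Y s').
Proof.
elim/term_nested_ind: s u' => [w|f a IH] u' /= [].
- move=> [s [r [Rsr Es ->]]]; exists r => // Y.
  have {Es} Es : s = Var L w by rewrite -[s](@sterm_ofK X) -Es.
  by have := spar_rule Y Rsr; rewrite Es.
- by move=> ->; exists (Var L w) => // Y; right.
- move=> [s [r [Rsr Es ->]]]; exists r => // Y.
  have {Es} Es : s = Fun a.
    by rewrite -[s](@sterm_ofK X) -Es -[RHS](@sterm_ofK X).
  by have := spar_rule Y Rsr; rewrite Es.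
move=> [a' -> aa'].
have /fin_all_exists2[b Eb bP] i :
    exists2 s', a' i = sterm_of X s' &
      forall Y, spar (sterm_of Y (a i)) (sterm_of Y s').
  by apply: IH; have := aa' i; rewrite ffunE.
exists (Fun [ffun i => b i]) => /= [|Y].
  by congr SFun; apply/ffunP => i; rewrite !ffunE.
by apply: spar_fun => i; rewrite !ffunE.
Qed.

(** This closure condition resolves all critical pairs.  Taking for [spar] a
    single rule, it also covers two rules with the same redex: [R s r] and
    [R s s'] give [R s' r]. *)
Hypothesis R_par : forall s s' r,
  R s r -> spar (sterm_of [::] s) (sterm_of [::] s') -> R s' r.

Lemma spar_diamond_rule X s r (u : sterm L X) :
  R s r -> spar (sterm_of X s) u -> spar u (sterm_of X r).
Proof.
move=> Rsr /spar_sterm_of[s' -> ss'].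
by apply/spar_rule/(R_par Rsr).
Qed.

(** If one of the two steps is a rule applied at the root, its result already
    closes the diamond; otherwise both steps act inside the arguments. *)
Lemma spar_diamond X (u u1 u2 : sterm L X) : spar u u1 -> spar u u2 ->
  exists2 u3, spar u1 u3 & spar u2 u3.
Proof.
have rule s r (w : sterm L X) : R s r -> spar (sterm_of X s) w ->
    exists2 w', spar (sterm_of X r) w' & spar w w'.
  move=> Rsr sw; exists (sterm_of X r); first exact: spar_refl.
  exact: spar_diamond_rule Rsr _.
have swap (w w' : sterm L X) : (exists2 w3, spar w w3 & spar w' w3) ->
    exists2 w3, spar w' w3 & spar w w3.
  by move=> [w3]; exists w3.
elim/sterm_nested_ind: u u1 u2 => [w|x xX|f a IH] u1 u2 u_u1 u_u2.
- case: (u_u1) => [[s [r [Rsr Eu ->]]]|->].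
    by apply: rule Rsr _; rewrite -Eu.
  by exists u2; [|exact: spar_refl].
- case: (u_u1) => [[s [r [Rsr Eu ->]]]|->].
    by apply: rule Rsr _; rewrite -Eu.
  by exists u2; [|exact: spar_refl].
case: (u_u1) => [[s [r [Rsr Eu ->]]]|[a1 E1 a_a1]].
  by apply: rule Rsr _; rewrite -Eu.
case: (u_u2) => [[s [r [Rsr Eu ->]]]|[a2 E2 a_a2]].
  by apply/swap; apply: rule Rsr _; rewrite -Eu.
have /fin_all_exists2[a3 a13 a23] i := IH i _ _ (a_a1 i) (a_a2 i).
exists (SFun [ffun i => a3 i]).
  by rewrite E1; apply: spar_fun => i; rewrite ffunE.
by rewrite E2; apply: spar_fun => i; rewrite ffunE.
Qed.

Lemma fpar_diamond X (F F1 F2 : sformula L X) : fpar F F1 -> fpar F F2 ->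
  exists2 F3, fpar F1 F3 & fpar F2 F3.
Proof.
elim: F F1 F2 => {X} /=.
- move=> X a b F1 F2 [a1 [b1 [-> aa1 bb1]]] [a2 [b2 [-> aa2 bb2]]].
  have [a3 a13 a23] := spar_diamond aa1 aa2.
  have [b3 b13 b23] := spar_diamond bb1 bb2.
  by exists (Eq a3 b3); exists a3, b3.
- move=> X T a F1 F2 [a1 -> aa1] [a2 -> aa2].
  have /fin_all_exists2[a3 a13 a23] i := spar_diamond (aa1 i) (aa2 i).
  by exists (Rel [ffun i => a3 i]); eexists=> // i; rewrite ffunE.
- by move=> X F1 F2 -> ->; exists (Bot L X).
- move=> X A IH F1 F2 [A1 -> /IH{}IH] [A2 -> /IH[A3 A13 A23]].
  by exists (Neg A3); exists A3.
1-3: move=> X A IHA B IHB F1 F2 [A1 [B1 [-> /IHA{}IHA /IHB{}IHB]]];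
     move=> [A2 [B2 [-> /IHA[A3 A13 A23] /IHB[B3 B13 B23]]]];
     by eexists; exists A3, B3; split.
all: move=> X x A IH F1 F2 [A1 -> /IH{}IH] [A2 -> /IH[A3 A13 A23]];
     by eexists; exists A3.
Qed.

End Parallel.

(** * Parallel reduction as a sequence of substitutions *)

(** Passes from [a] to [a'] through functions that agree with [a'] on a growing
    part of [I] and with [a] elsewhere, so that only one value changes at a
    time. *)
Lemma ffun_exchange (I : finType) T (Q : {ffun I -> T} -> Prop)
    (a a' : {ffun I -> T}) :
  (forall i (b : {ffun I -> T}), Q [ffun j => if j == i then a i else b j] ->
                Q [ffun j => if j == i then a' i else b j]) ->
  Q a -> Q a'.
Proof.
move=> Qi Qa; pose h (s : seq I) := [ffun j => if j \in s then a' j else a j].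
suff Qh s : Q (h s).
  have -> : a' = h (enum I) by apply/ffunP => j; rewrite ffunE mem_enum.
  exact: Qh.
elim: s => [|i s IH].
  by have -> : h [::] = a by apply/ffunP => j; rewrite ffunE.
case: (boolP (i \in s)) => si.
  have -> // : h (i :: s) = h s.
  by apply/ffunP => j; rewrite !ffunE inE; case: eqP => // ->; rewrite si.
have -> : h (i :: s) = [ffun j => if j == i then a' i else h s j].
  by apply/ffunP => j; rewrite !ffunE inE; case: eqP => // ->.
apply: Qi; suff <- : h s = [ffun j => if j == i then a i else h s j] by [].
apply/ffunP => j; rewrite !ffunE; case: eqP => // ->.
by rewrite (negPf si).
Qed.

Section SingleSteps.

Variables (R : term L -> term L -> Prop) (P : formula L -> Prop).

Hypothesis P_step : forall (F : formula L) v s r,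
  ~~ occurs v s -> ~~ occurs v r -> R s r -> P F{[v / s]} -> P F{[v / r]}.

(** Contexts are functions into formulae; commuting with the substitution of
    a fresh variable is all that is needed to view [K (sterm_of X s)] as an
    instance of the formula [K (SFree L X v)]. *)
Definition scontext X (K : sterm L X -> formula L) : Prop :=
  eventually (fun v => forall t u, K (ssubst v t u) = (K u){[v / t]}).

Definition fcontext X (K : sformula L X -> formula L) : Prop :=
  eventually (fun v => forall t A, K (fsubst v t A) = (K A){[v / t]}).

(** A property closed under the replacement of single terms is closed under
    replacement in any context: fill the hole with a fresh variable. *)
Lemma scontext_rule X (K : sterm L X -> formula L) s r :
  scontext K -> R s r -> P (K (sterm_of X s)) -> P (K (sterm_of X r)).
Proof.
move=> cK Rsr.
have [n /(_ n (leqnn n))[[EK v_s] v_r]] :=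
  eventually_and (eventually_and cK (occurs_fresh s)) (occurs_fresh r).
have EKn t : K (sterm_of X t) = (K (SFree L X n)){[n / t]}.
  by rewrite -EK /= eqxx.
by rewrite !EKn; apply: P_step.
Qed.

(** The context is universally quantified in the induction, since a reduction
    of an argument takes place in the context that holds the other arguments
    fixed. *)
Lemma scontext_spar X (K : sterm L X -> formula L) u u' :
  scontext K -> spar R u u' -> P (K u) -> P (K u').
Proof.
elim/sterm_nested_ind: u u' K => [w|x xX|f a IH] u' K cK /=.
1-2: case=> [[s [r [Rsr -> ->]]]|-> //]; exact: scontext_rule.
case=> [[s [r [Rsr -> ->]]]|[a' -> aa']]; first exact: scontext_rule.
apply: (ffun_exchange (Q := fun b => P (K (SFun b)))) => i b.
pose K' u := K (SFun [ffun j => if j == i then u else b j]).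
apply: (IH i (a' i) K') => //.
have fresh_b := eventually_all (fun j => ssubst_fresh (b j)).
apply: eventually_imp (eventually_and cK fresh_b) => v [EK Eb] t u.
rewrite /K' -EK /=; congr (K (SFun _)); apply/ffunP => j; rewrite !ffunE.
by case: eqP.
Qed.

Lemma fcontext_opl X (op : sformula L X -> sformula L X -> sformula L X) K B :
  (forall v t A1 A2,
    fsubst v t (op A1 A2) = op (fsubst v t A1) (fsubst v t A2)) ->
  fcontext K -> fcontext (fun A => K (op A B)).
Proof.
move=> op_subst cK.
apply: eventually_imp (eventually_and cK (fsubst_fresh B)).
by move=> v [EK EB] t A; rewrite -EK op_subst EB.
Qed.

Lemma fcontext_opr X (op : sformula L X -> sformula L X -> sformula L X) K A :
  (forall v t A1 A2,
    fsubst v t (op A1 A2) = op (fsubst v t A1) (fsubst v t A2)) ->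
  fcontext K -> fcontext (fun B => K (op A B)).
Proof.
move=> op_subst cK.
apply: eventually_imp (eventually_and cK (fsubst_fresh A)).
by move=> v [EK EA] t B; rewrite -EK op_subst EA.
Qed.

Lemma fcontext_fpar X (K : sformula L X -> formula L) F F' :
  fcontext K -> fpar R F F' -> P (K F) -> P (K F').
Proof.
elim: F F' K => {X} [X a b|X T a|X|X A IH|X A IHA B IHB|X A IHA B IHB
                    |X A IHA B IHB|X x A IH|X x A IH] F' K cK /=.
- move=> [a' [b' [-> aa' bb']]] PK.
  apply: (scontext_spar (K := fun u => K (Eq a' u))) bb' _.
    apply: eventually_imp (eventually_and cK (ssubst_fresh a')).
    by move=> v [EK Ea] t u; rewrite -EK /= Ea.
  apply: (scontext_spar (K := fun u => K (Eq u b))) aa' PK.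
  apply: eventually_imp (eventually_and cK (ssubst_fresh b)).
  by move=> v [EK Eb] t u; rewrite -EK /= Eb.
- move=> [a' -> aa'].
  apply: (ffun_exchange (Q := fun b => P (K (Rel b)))) => i b.
  apply: (scontext_spar
    (K := fun u => K (Rel [ffun j => if j == i then u else b j]))) (aa' i).
  have fresh_b := eventually_all (fun j => ssubst_fresh (b j)).
  apply: eventually_imp (eventually_and cK fresh_b) => v [EK Eb] t u.
  rewrite -EK /=; congr (K (Rel _)); apply/ffunP => j; rewrite !ffunE.
  by case: eqP.
- by move=> ->.
- move=> [A' -> AA']; apply: (IH A' (fun A => K (Neg A))) AA'.
  by apply: eventually_imp cK => v EK t u; rewrite -EK.
1-3: by move=> [A' [B' [-> AA' BB']]] PK;
     apply: IHB (fcontext_opr _ _ cK) BB' _; first by [];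
     apply: IHA (fcontext_opl _ _ cK) AA' PK.
- move=> [A' -> AA']; apply: (IH A' (fun A => K (All A))) AA'.
  by apply: eventually_imp cK => v EK t u; rewrite -EK.
move=> [A' -> AA']; apply: (IH A' (fun A => K (Ex A))) AA'.
by apply: eventually_imp cK => v EK t u; rewrite -EK.
Qed.

Lemma step_closed_fpar (F F' : formula L) : fpar R F F' -> P F -> P F'.
Proof. by apply: (@fcontext_fpar _ id); exists 0. Qed.

End SingleSteps.

(** The form suited to derivability, which the right rule carries from the
    reduct to the redex. *)
Lemma step_opclosed_fpar (R : term L -> term L -> Prop)
    (P : formula L -> Prop) F F' :
  (forall (F : formula L) v s r, ~~ occurs v s -> ~~ occurs v r -> R s r ->
    P F{[v / r]} -> P F{[v / s]}) ->
  fpar R F F' -> P F' -> P F.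
Proof.
move=> P_step /(step_closed_fpar (P := fun A => P A -> P F)); apply=> //.
by move=> A v s r v_s v_r sr PAF /(P_step _ _ _ _ v_s v_r sr).
Qed.

(** * Structural rules *)

Section Calculus.

Variable i : Defs.index.
Implicit Types (G D : seq (formula L)) (A F H : formula L).

Lemma In_cat A G D : List.In A (G ++ D) <-> List.In A G \/ List.In A D.
Proof. by elim: G => [|B G IH] /=; tauto. Qed.

Lemma In_split A G : List.In A G -> exists G1 G2, G = G1 ++ A :: G2.
Proof.
elim: G => //= B G IH [->|/IH[G1 [G2 ->]]]; first by exists [::], G.
by exists (B :: G1), G2.
Qed.

Lemma cfEQ_move G D A H :
  cfEQ i (G ++ A :: D) H <-> cfEQ i (G ++ D ++ [:: A]) H.
Proof.
elim: D G => [|B D IH] G //=.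
have := IH (G ++ [:: B]); rewrite -!catA /= => <-.
by split; apply: cf_exch.
Qed.

Lemma cfEQ_contr_in G A H :
  List.In A G -> cfEQ i (G ++ [:: A]) H -> cfEQ i G H.
Proof.
move=> /In_split[G1 [G2 ->]]; rewrite -catA /= => /cfEQ_move.
rewrite -!catA /= => dH; apply/cfEQ_move; rewrite catA.
by apply: cf_contr; rewrite -catA.
Qed.

Lemma cfEQ_weak_front D G H : cfEQ i G H -> cfEQ i (D ++ G) H.
Proof.
elim: D => //= A D IH /IH dH.
by apply/(cfEQ_move [::]); apply: cf_weak.
Qed.

(** * Saturated antecedents *)

(** The premises of [saturation_step] are the two formulae that [cf_eql]
    introduces, and its conclusion the one that [cf_eql] consumes. *)
Inductive saturation G : formula L -> Prop :=
| saturation_in A : List.In A G -> saturation G A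
| saturation_step F v s r : ~~ occurs v s -> ~~ occurs v r ->
    saturation G (eq_intro i r s) -> saturation G F{[v / s]} ->
    saturation G F{[v / r]}.

Definition rule G (s r : term L) : Prop := saturation G (eq_intro i r s).

Lemma saturation_trans G G' A :
  (forall B, List.In B G -> saturation G' B) ->
  saturation G A -> saturation G' A.
Proof.
move=> GG'; elim=> [B /GG' //|F v s r v_s v_r _ IHe _ IHF].
exact: saturation_step IHe IHF.
Qed.

Lemma saturation_fpar G A A' :
  fpar (rule G) A A' -> saturation G A -> saturation G A'.
Proof.
by apply: step_closed_fpar => F v s r v_s v_r; apply: saturation_step.
Qed.

(** The rules of a saturation contain their own critical pairs, because their
    equations are rewritten along with everything else. *)
Lemma rule_par G s s' r :
  rule G s r -> spar (rule G) (sterm_of [::] s) (sterm_of [::] s') ->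
  rule G s' r.
Proof.
move=> sr ss'; apply: saturation_fpar sr; have := spar_refl (rule G).
by rewrite /eq_intro; case: (i) => refl /=; do 2!eexists; split.
Qed.

(** This is cut for members of the saturation.  A formula reached by
    a replacement is exchanged by [cf_eql] for the formula and the equation it
    came from, which are then removed in turn. *)
Lemma cfEQ_cut_saturation G A H :
  saturation G A -> cfEQ i (G ++ [:: A]) H -> cfEQ i G H.
Proof.
(* The antecedent must be allowed to grow: while the equation is removed,
   the other formula is still present. *)
suff cut G' : saturation G A -> List.incl G G' ->
    cfEQ i (G' ++ [:: A]) H -> cfEQ i G' H.
  by move=> GA; apply: cut GA (List.incl_refl G).
move=> GA; elim: GA G' => {A} [A GA|F v s r v_s v_r _ IHe _ IHF] G' GG' dH.
  exact: cfEQ_contr_in (GG' _ GA) dH.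
apply: (IHF G') => //; apply: IHe.
  by move=> B /GG' G'B; rewrite In_cat; left.
by rewrite -catA; apply: cf_eql dH.
Qed.

(** * Derivability as rewriting *)

(** Bottom-up proof search: the goal is rewritten until it becomes an axiom. *)
Inductive rderivable G : formula L -> Prop :=
| rderivable_ax A : saturation G A -> rderivable G A
| rderivable_refl t : rderivable G (t ≐ t)
| rderivable_par A A' :
    fpar (rule G) A A' -> rderivable G A' -> rderivable G A.

(** This is where confluence enters: reduction of the goal, the converse of
    the constructor [rderivable_par], loses no derivations. *)
Lemma rderivable_fpar G A A' :
  fpar (rule G) A A' -> rderivable G A -> rderivable G A'.
Proof.
move=> AA' GA; elim: GA A' AA' => {A} [A GA|t|A B AB _ IH] A' AA'.
- exact: rderivable_ax (saturation_fpar AA' GA).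
- case: AA' => [a [b [-> ta tb]]].
  have [c ac bc] := spar_diamond (@rule_par G) ta tb.
  have [t1 Ea _] := spar_sterm_of ta; rewrite Ea in ac *.
  have [t2 Ec _] := spar_sterm_of ac; rewrite Ec in ac bc.
  by apply: rderivable_par (rderivable_refl G t2); do 2!eexists; split.
have [B' BB' A'B'] := fpar_diamond (@rule_par G) AB AA'.
exact: rderivable_par A'B' (IH _ BB').
Qed.

Lemma rderivable_mono G G' A :
  (forall B, List.In B G -> saturation G' B) ->
  rderivable G A -> rderivable G' A.
Proof.
move=> GG'; elim=> {A} [A GA|t|A B AB _ G'B].
- exact/rderivable_ax/saturation_trans/GA.
- exact: rderivable_refl.
move: G'B; apply: step_opclosed_fpar AB => F v s r _ _ sr.
apply/rderivable_par/fpar_subst; exact: saturation_trans sr.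
Qed.

(** The left rule holds because everything available in its premise belongs to
    the saturation of the antecedent of its conclusion. *)
Lemma cfEQ_rderivable G H : cfEQ i G H -> rderivable G H.
Proof.
have incl D D' F : List.incl D D' -> rderivable D F -> rderivable D' F.
  by move=> DD'; apply: rderivable_mono => B /DD'; apply: saturation_in.
elim=> {G H} [F|t|G F H _ IH|G D A B H _ IH|G F H _ IH
             |G F v r s v_r v_s _ IH|G F H v r s v_r v_s _ IH].
- by apply/rderivable_ax/saturation_in; left.
- exact: rderivable_refl.
- by apply: incl IH => B; rewrite In_cat; left.
- by apply: incl IH => C; rewrite !In_cat /=; tauto.
- by apply: incl IH => C; rewrite !In_cat /=; tauto.
- have /rderivable_par :
      fpar (rule (G ++ [:: eq_intro i r s])) F{[v / s]} F{[v / r]}.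
    by apply/fpar_subst/saturation_in; rewrite In_cat; right; left.
  by apply; apply: incl IH => B; rewrite In_cat; left.
apply: rderivable_mono IH => B; rewrite In_cat => -[GB|[<-|[]]].
  by apply/saturation_in; rewrite In_cat; left.
apply: saturation_step v_s v_r _ _; apply: saturation_in; rewrite In_cat /=.
  by tauto.
by tauto.
Qed.

Lemma rderivable_cfEQ G H : rderivable G H -> cfEQ i G H.
Proof.
elim=> {H} [A GA|t|A B AB _ GB].
- apply: cfEQ_cut_saturation GA _.
  exact/(cfEQ_weak_front G)/cf_ax.
- by rewrite -[G]cats0; apply/cfEQ_weak_front/cf_refl.
move: GB; apply: step_opclosed_fpar AB => F v s r v_s v_r sr dF.
exact/(cfEQ_cut_saturation sr)/cf_eqr.
Qed.

(** With the equation reversed, [r] is rewritten to [s], so the goal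
    [F{[v / s]}] is a reduct of the derivable [F{[v / r]}]. *)
Lemma converse_rule_admissible G F v (r s : term L) :
  cfEQ i G F{[v / r]} -> cfEQ i (G ++ [:: eq_intro i s r]) F{[v / s]}.
Proof.
move=> /cfEQ_rderivable dF; apply: rderivable_cfEQ.
apply: (@rderivable_fpar _ F{[v / r]}).
  by apply/fpar_subst/saturation_in; rewrite In_cat; right; left.
apply: rderivable_mono dF => B GB.
by apply: saturation_in; rewrite In_cat; left.
Qed.

End Calculus.

End Language.

Theorem proposition1p13 (L : signature) :
  (forall (G : seq (formula L)) (F : formula L) (v : fvar) (r s : term L),
      ~~ occurs v r -> ~~ occurs v s ->
      cfEQ I1 G F{[v / r]} -> cfEQ I1 (G ++ [:: s ≐ r]) F{[v / s]})
  /\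
  (forall (G : seq (formula L)) (F : formula L) (v : fvar) (r s : term L),
      ~~ occurs v r -> ~~ occurs v s ->
      cfEQ I2 G F{[v / r]} -> cfEQ I2 (G ++ [:: r ≐ s]) F{[v / s]}).
Proof.
split=> G F v r s _ _.
  exact: (@converse_rule_admissible L I1).
exact: (@converse_rule_admissible L I2).
Qed.
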